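(* Let $A \in \mathbb{R}^{n\times n}$, let $\mathcal{X}_0 \subset \mathbb{R}^n$ be a closed and convex set, let $\delta > 0$, and let $\Phi = e^{A\delta}$. Define the pair of sets $$\Omega_0^+ = CH\big(\mathcal{X}_0,\ \Phi \mathcal{X}_0 \oplus E^+(A, \mathcal{X}_0, \delta)\big), \qquad \Omega_0^- = CH\big(\Phi \mathcal{X}_0,\ \mathcal{X}_0 \oplus E^+(A, \Phi \mathcal{X}_0, \delta)\big),$$ where $E^+(A, \mathcal{X}_0, \delta) = \boxdot\big(P(|A|, \delta)\,\boxdot(A^2 \mathcal{X}_0)\big)$ (and likewise with $\Phi\mathcal{X}_0$ in place of $\mathcal{X}_0$) and $P(A, \delta) = \sum_{i=0}^\infty A^i \delta^{i+2}/(i+2)!$ (and likewise with $|A|$ in place of $A$). Then the set $\Omega_0 := \Omega_0^+ \cap \Omega_0^-$ encloses $\Omega_0^e$, i.e. $\Omega_0^e \subseteq \Omega_0$. Moreover, $\Omega_0 \to \Omega_0^e$ as $\delta \to 0$.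
   Context: Consider the initial-value problem $\dot{x}(t) = A x(t)$, $x(0) \in \mathcal{X}_0$, with state $x(t) \in \mathbb{R}^n$. Its exact reach-set over the time interval $[0,\delta]$ is $\Omega_0^e = \{ e^{As} x_0 : x_0 \in \mathcal{X}_0,\ s \in [0,\delta] \}$. $|A|$ denotes the matrix of component-wise absolute values of $A$. For a matrix $M$ and a set $\mathcal{Y}$, $M\mathcal{Y} = \{My : y \in \mathcal{Y}\}$. $\oplus$ is the Minkowski sum: $X \oplus Y = \{x+y : x\in X,\ y \in Y\}$. $CH(X,Y)$ denotes the convex hull of the union of two sets $X, Y \subseteq \mathbb{R}^n$, i.e. the smallest convex set containing $X$ and $Y$, given (for the convex sets used here) by $CH(X,Y) = \{ \lambda x + (1-\lambda) y : \lambda \in [0,1],\ x \in X,\ y \in Y\}$. A hyperrectangle with center $c \in \mathbb{R}^n$ and radius $r \in \mathbb{R}^n$ is $\{x \in \mathbb{R}^n : |x_i - c_i| \le r_i,\ i=1,\dots,n\}$. $\boxdot(\mathcal{Y})$ denotes the symmetric interval hull of $\mathcal{Y} \subset \mathbb{R}^n$: the smallest hyperrectangle centered at the origin that contains $\mathcal{Y}$.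
   Formalization: The convergence claim is stated for bounded initial sets and means that the Hausdorff distance tends to 0 as δ → 0+; for unbounded closed convex sets it can fail, e.g. A = [[0,1],[0,0]] with the initial set {(0,y)}. The enclosure needs no boundedness. *)

(* Defs.v *)
From mathcomp Require Import all_boot all_order all_algebra.
From mathcomp Require Import all_classical all_reals all_analysis.
Import Order.TTheory GRing.Theory Num.Theory numFieldNormedType.Exports.

Set Implicit Arguments.
Unset Strict Implicit.
Unset Printing Implicit Defensive.

Local Open Scope classical_set_scope.
Local Open Scope ring_scope.

Section Matrices.
Context {R : realType} {n : nat}.
Implicit Types (A : 'M[R]_n) (delta : R).

Definition expmx A : 'M[R]_n :=
  limn (series (fun k => (k`!%:R)^-1 *: A ^+ k)).

(* $\sum_{i \ge 0} A^i \delta^{i+2}/(i+2)!$ *)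
Definition Pmx A delta : 'M[R]_n :=
  limn (series (fun i => (delta ^+ i.+2 / (i.+2)`!%:R) *: A ^+ i)).

Definition abs_mx A : 'M[R]_n := map_mx (fun a => `|a|) A.

End Matrices.

Section Sets.
Context {R : realType} {n : nat}.
Implicit Types (A M : 'M[R]_n) (X Y : set 'cV[R]_n) (delta : R).

Definition image_mx M Y : set 'cV[R]_n := [set M *m y | y in Y].

Definition minkowski_sum X Y : set 'cV[R]_n := [set x + y | x in X & y in Y].

Definition CH X Y : set 'cV[R]_n :=
  smallest (@convex_set R 'cV[R]_n) (X `|` Y).

Definition hyperrectangle (c r : 'cV[R]_n) : set 'cV[R]_n :=
  [set x | forall i, `|x i 0 - c i 0| <= r i 0].

Definition centered_hyperrectangle X : Prop :=
  exists r, X = hyperrectangle 0 r.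

(* [smallest] is the intersection of all centered hyperrectangles containing
   [Y]. It is itself one when [Y] is bounded; since radii are real, it is the
   whole space when [Y] is unbounded. *)
Definition sym_interval_hull Y : set 'cV[R]_n :=
  smallest centered_hyperrectangle Y.

Definition Eplus A Y delta : set 'cV[R]_n :=
  sym_interval_hull (image_mx (Pmx (abs_mx A) delta)
                       (sym_interval_hull (image_mx (A ^+ 2) Y))).

Definition reach_set A X delta : set 'cV[R]_n :=
  [set expmx (s *: A) *m x0 | s in `[0, delta] & x0 in X].

Definition Omega0_plus A X delta : set 'cV[R]_n :=
  let Phi := expmx (delta *: A) in
  CH X (minkowski_sum (image_mx Phi X) (Eplus A X delta)).

Definition Omega0_minus A X delta : set 'cV[R]_n :=
  let Phi := expmx (delta *: A) in
  CH (image_mx Phi X) (minkowski_sum X (Eplus A (image_mx Phi X) delta)).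

Definition Omega0 A X delta : set 'cV[R]_n :=
  Omega0_plus A X delta `&` Omega0_minus A X delta.

End Sets.

Section Hausdorff.
Context {R : realType} {V : normedModType R}.
Implicit Types X Y : set V.

Definition thickening X (e : R) : set V :=
  [set v | exists2 x, X x & `|v - x| <= e].

(* The infimum over thickenings, rather than a supremum of point-to-set
   distances, gives distance 0 between two empty sets; it is +oo when no
   radius works. *)
Definition hausdorff_distance X Y : \bar R :=
  ereal_inf [set e%:E | e in
    [set e : R | [/\ 0 <= e, X `<=` thickening Y e & Y `<=` thickening X e]]].

End Hausdorff.

(* Main.v *)
Require Import Defs.
From mathcomp Require Import all_boot all_order all_algebra.
From mathcomp Require Import all_classical all_reals all_analysis.
From mathcomp Require Import ring.
Import Order.TTheory GRing.Theory Num.Theory numFieldNormedType.Exports.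

(** Splitting the exponential series after its linear term gives
    [e^{cA} = 1 + cA + P(A, c) A^2] ([expmx_Pmx]). For [0 <= s <= delta]
    compare the trajectory with its chord at parameter [l = s / delta]: the
    terms of order 0 and 1 cancel in [e^{sA} x - (1 - l) x - l e^{delta A} x],
    and what remains is [l e] with [e] a power series in [A] applied to
    [A^2 x]. The [k]-th coefficient of that series is
    [(s^(k+1) delta - delta^(k+2)) / (k+2)!], of absolute value at most
    [delta^(k+2) / (k+2)!], so entry by entry [|e| <= P(|A|, delta) |A^2 x|],
    which puts [e] in [E^+(A, X0, delta)] ([flow_chord]). Thus every point of
    the trajectory is a convex combination of a point of [X0] and a point of
    [Phi X0 + E^+(A, X0, delta)].

    The backward enclosure is the same statement for [-A], started at [Phi x]
    and run for the time [delta - s]: neither [|A|] nor [A^2] sees the sign,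
    and [e^{(delta - s)(-A)} Phi x = e^{sA} x] by the functional equation of
    the exponential. That equation is an instance of a Cauchy product formula
    for matrix power series ([mxpseriesM]).

    For the limit it suffices to bound [Omega0^+], since [X0] is contained in
    the reach set (time 0) and the reach set in [Omega0]. If [X0] is bounded,
    both [Phi x - x] for [x] in [X0] and the points of [E^+] are [O(delta)]
    uniformly, so [X0] and [Phi X0 + E^+] lie in the closed
    [K delta]-thickening of [X0] for a fixed [K]. This thickening is convex
    because [X0] is, hence contains the whole hull [Omega0^+]
    ([Omega0_plus_sub]).

    All estimates are made through one relation, entrywise domination
    [|A i j| <= B i j], which is compatible with sums, products and power
    series; centered hyperrectangles are the sets of vectors dominated by
    their radius. *)

Set Implicit Arguments.
Unset Strict Implicit.
Unset Printing Implicit Defensive.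

Local Open Scope classical_set_scope.
Local Open Scope ring_scope.

(** * Entrywise domination of matrices *)

Section Domination.
Context {R : realType}.

Definition mxdom {m n} (A B : 'M[R]_(m, n)) : Prop :=
  forall i j, `|A i j| <= B i j.

Lemma mxdom_abs {m n} (A : 'M[R]_(m, n)) : mxdom A (map_mx Num.norm A).
Proof. by move=> i j; rewrite mxE. Qed.

Lemma mxdom_absl {m n} (A B : 'M[R]_(m, n)) :
  mxdom A B -> mxdom (map_mx Num.norm A) B.
Proof. by move=> AB i j; rewrite mxE normr_id. Qed.

Lemma mxdom_absr {m n} (A B : 'M[R]_(m, n)) :
  mxdom A B -> mxdom A (map_mx Num.norm B).
Proof. by move=> AB i j; rewrite mxE (le_trans (AB i j)) ?ler_norm. Qed.

Lemma mxdom_trans {m n} (A B C : 'M[R]_(m, n)) :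
  mxdom A B -> mxdom B C -> mxdom A C.
Proof.
by move=> AB BC i j; rewrite (le_trans (AB i j))// (le_trans (ler_norm _)).
Qed.

Lemma mxdomD {m n} (A B A' B' : 'M[R]_(m, n)) :
  mxdom A A' -> mxdom B B' -> mxdom (A + B) (A' + B').
Proof.
by move=> AA BB i j; rewrite !mxE (le_trans (ler_normD _ _))// lerD.
Qed.

Lemma mxdomZ {m n} (a b : R) (A B : 'M[R]_(m, n)) :
  `|a| <= b -> mxdom A B -> mxdom (a *: A) (b *: B).
Proof. by move=> ab AB i j; rewrite !mxE normrM ler_pM. Qed.

Lemma mxdom_mul {m n p} (A A' : 'M[R]_(m, n)) (B B' : 'M[R]_(n, p)) :
  mxdom A A' -> mxdom B B' -> mxdom (A *m B) (A' *m B').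
Proof.
move=> AA BB i j; rewrite !mxE (le_trans (ler_norm_sum _ _ _))//.
by apply: ler_sum => k _; rewrite normrM ler_pM.
Qed.

Lemma mxdom_exp {n} (A B : 'M[R]_n) k :
  mxdom A B -> mxdom (A ^+ k) (B ^+ k).
Proof.
move=> AB; elim: k => [|k IHk]; last by rewrite !exprS; apply: mxdom_mul.
by move=> i j; rewrite !expr0 !mxE; case: (i == j); rewrite ?normr0 ?normr1.
Qed.

Lemma mxentry_le_norm {m n} (x : 'M[R]_(m, n)) i j : `|x i j| <= `|x|.
Proof.
rewrite [leRHS]/Num.Def.normr/= mx_normrE.
by apply/bigmax_geP; right; exists (i, j).
Qed.

Lemma mxdom_norm {m n} (x y : 'M[R]_(m, n)) : mxdom x y -> `|x| <= `|y|.
Proof.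
move=> xy; rewrite [leLHS]/Num.Def.normr/= mx_normrE.
rewrite (bigmax_le _ (normr_ge0 y))//= => -[i j] _ /=.
by rewrite (le_trans (xy i j))// (le_trans (ler_norm _))// mxentry_le_norm.
Qed.

Lemma mxdom_const_norm {m n} (x : 'M[R]_(m, n)) (K : R) :
  `|x| <= K -> mxdom x (const_mx K).
Proof.
by move=> xK i j; rewrite mxE (le_trans (mxentry_le_norm x i j)).
Qed.

(** An entrywise l1 norm: it bounds every column sum, and therefore the
    multiplication of any row vector by [A] in the sup norm. *)
Definition mxsum {n} (A : 'M[R]_n) : R := \sum_p \sum_q `|A p q|.

Lemma mxsum_ge0 {n} (A : 'M[R]_n) : 0 <= mxsum A.
Proof. by apply: sumr_ge0 => p _; apply: sumr_ge0. Qed.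

(** The sup norm of matrices is not submultiplicative; peeling off one factor
    at a time and bounding each column by the full entry sum avoids a
    dimension factor. *)
Lemma norm_mxexp_le {n} (A : 'M[R]_n) k : `|A ^+ k| <= mxsum A ^+ k.
Proof.
have colM j : \sum_p `|A p j| <= mxsum A.
  by apply: ler_sum => p _; rewrite (bigD1 j)//= lerDl sumr_ge0.
rewrite [leLHS]/Num.Def.normr/= mx_normrE bigmax_le ?exprn_ge0 ?mxsum_ge0//.
case=> i j _ /=; elim: k i j => [|k IHk] i j.
  by rewrite !expr0 mxE; case: (i == j); rewrite ?normr0 ?normr1.
rewrite exprSr mxE (le_trans (ler_norm_sum _ _ _))//.
rewrite exprSr (le_trans _ (ler_wpM2l _ (colM j))) ?exprn_ge0 ?mxsum_ge0//.
by rewrite mulr_sumr ler_sum// => p _; rewrite normrM ler_wpM2r.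
Qed.

End Domination.

(** * Limits of matrices, entry by entry *)

Section MatrixLimits.
Context {R : realType}.

Lemma cvg_mxP {m n} (f : nat -> 'M[R]_(m, n)) (L : 'M[R]_(m, n)) :
  f @ \oo --> L <-> forall i j, f k i j @[k --> \oo] --> L i j.
Proof.
split=> [fL i j|fL].
  exact: (cvg_comp _ _ fL (@coord_continuous _ _ _ i j L)).
apply/cvgrPdist_le => e e0.
have : \forall k \near \oo, forall ij : 'I_m * 'I_n,
    `|L ij.1 ij.2 - f k ij.1 ij.2| <= e.
  apply: filter_forall => -[i j] /=.
  by move: (fL i j) => /cvgrPdist_le; exact.
apply: filterS => k fk; rewrite [leLHS]/Num.Def.normr/= mx_normrE.
by rewrite bigmax_le ?ltW//= => ij _; rewrite !mxE.
Qed.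

Lemma cvg_mulmx {m n p} (f : nat -> 'M[R]_(m, n)) (g : nat -> 'M[R]_(n, p))
    (A : 'M[R]_(m, n)) (B : 'M[R]_(n, p)) :
  f @ \oo --> A -> g @ \oo --> B -> f k *m g k @[k --> \oo] --> A *m B.
Proof.
move=> /cvg_mxP fA /cvg_mxP gB; apply/cvg_mxP => i j; rewrite mxE.
under eq_fun do rewrite mxE.
apply: cvg_big => [|k _]; [exact: add_continuous|exact: cvgM].
Qed.

End MatrixLimits.

(** * Power series of a matrix *)

Section PowerSeries.
Context {R : realType}.
Implicit Types (a b : nat -> R) (s t : R).

(** Coefficients dominated by those of an exponential series: a class of
    entire series that is stable under Cauchy products and whose convergence
    follows from that of the exponential. *)
Definition expdom a : Prop :=
  exists C c, [/\ 0 <= C, 0 <= c & forall k, `|a k| <= C * exp_coeff c k].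

Lemma normr_exp_coeff s k : `|exp_coeff s k| = exp_coeff `|s| k.
Proof. by rewrite /exp_coeff /= normrM normrX normfV normr_nat. Qed.

Lemma expdom_exp_coeff s : expdom (exp_coeff s).
Proof. by exists 1, `|s|; split=> // k; rewrite mul1r normr_exp_coeff. Qed.

Lemma expdom_le a b : (forall k, `|a k| <= b k) -> expdom b -> expdom a.
Proof.
move=> ab [C [c [C0 c0 bC]]]; exists C, c; split=> // k.
by rewrite (le_trans (ab k))// (le_trans _ (bC k))// ler_norm.
Qed.

Lemma expdomZ s a : expdom a -> expdom (s \*o a).
Proof.
move=> [C [c [C0 c0 aC]]]; exists (`|s| * C), c; split=> [||k] //.
  by rewrite mulr_ge0.
by rewrite normrM -mulrA ler_wpM2l.
Qed.

Lemma exp_coeffM s t k : exp_coeff (s * t) k = exp_coeff s k * t ^+ k.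
Proof. by rewrite /exp_coeff /= exprMn mulrAC. Qed.

(** The binomial formula, divided by [k!]. *)
Lemma exp_coeffD s t k :
  exp_coeff (s + t) k = \sum_(i < k.+1) exp_coeff s i * exp_coeff t (k - i)%N.
Proof.
rewrite /exp_coeff /= addrC exprDn mulr_suml; apply: eq_bigr => -[i] /= ik _.
rewrite ltnS in ik; rewrite -(bin_fact ik) -mulr_natr.
have := fact_gt0 i; have := fact_gt0 (k - i).
have : (0 < 'C(k, i))%N by rewrite bin_gt0.
rewrite -!(ltr0n R) => b0 f1 f2; rewrite !natrM.
by field; rewrite !gt_eqF.
Qed.

Definition conv_coeff a b k := \sum_(i < k.+1) a i * b (k - i)%N.

Lemma ler_norm_conv a b a' b' k :
  (forall i, `|a i| <= a' i) -> (forall i, `|b i| <= b' i) ->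
  `|conv_coeff a b k| <= conv_coeff a' b' k.
Proof.
move=> aa bb; rewrite (le_trans (ler_norm_sum _ _ _))//.
by apply: ler_sum => i _; rewrite normrM ler_pM.
Qed.

(** The convolution of the majorants [C c^k/k!] and [D d^k/k!] is
    [C D (c + d)^k/k!]; absolute values are kept so that the result also
    bounds truncated convolutions. *)
Lemma expdom_conv a b : expdom a -> expdom b ->
  expdom (conv_coeff (Num.norm \o a) (Num.norm \o b)).
Proof.
move=> [C [c [C0 c0 aC]]] [D [d [D0 d0 bD]]].
exists (C * D), (c + d); split=> [||k]; rewrite ?mulr_ge0 ?addr_ge0//.
have nn (f : nat -> R) i : `|(Num.norm \o f) i| = `|f i| by rewrite /= normr_id.
rewrite (@le_trans _ _
    (conv_coeff (C \*o exp_coeff c) (D \*o exp_coeff d) k))//.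
  by apply: ler_norm_conv => i; rewrite nn.
rewrite exp_coeffD mulr_sumr; apply: ler_sum => i _.
by rewrite mulrACA.
Qed.

Context {n : nat}.
Implicit Types A B : 'M[R]_n.

Definition mxpseries a A : 'M[R]_n := limn (series (fun k => a k *: A ^+ k)).

(** Absolute convergence: [c^k/k! * M^k] is the exponential series at
    [c M]. *)
Lemma is_cvg_norm_series a A : expdom a ->
  cvgn (series (fun k => `|a k| * mxsum A ^+ k)).
Proof.
move=> [C [c [C0 c0 aC]]]; set M := mxsum A; have M0 : 0 <= M := mxsum_ge0 A.
apply: (@series_le_cvg _ _ (fun k => C * exp_coeff (c * M) k)) => [k|k|k|].
- by rewrite mulr_ge0// exprn_ge0.
- by rewrite mulr_ge0// exp_coeff_ge0// mulr_ge0.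
- by rewrite exp_coeffM mulrA ler_wpM2r// exprn_ge0.
rewrite [series _](_ : _ = C \*o series (exp_coeff (c * M))).
  by apply: is_cvgM; [exact: is_cvg_cst|exact: is_cvg_series_exp_coeff].
by apply: funext => N; rewrite [RHS]mulr_sumr.
Qed.

Lemma cvg_mxpseries a A : expdom a ->
  series (fun k => a k *: A ^+ k) @ \oo --> mxpseries a A.
Proof.
move=> /is_cvg_norm_series - /(_ A) cA.
have cij i j : cvgn (series (fun k => (a k *: A ^+ k) i j)).
  apply: (@normed_cvg _ R^o); apply: series_le_cvg cA => [k|k|k] /=.
  - exact: normr_ge0.
  - by rewrite mulr_ge0// exprn_ge0// mxsum_ge0.
  - rewrite mxE normrM ler_wpM2l// (le_trans (mxentry_le_norm _ i j))//.
    exact: norm_mxexp_le.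
suff : series (fun k => a k *: A ^+ k) @ \oo -->
  \matrix_(i, j) limn (series (fun k => (a k *: A ^+ k) i j)).
  by move=> h; rewrite /mxpseries (cvg_lim _ h).
apply/cvg_mxP => i j; rewrite mxE.
by under eq_fun do rewrite summxE; exact: cij.
Qed.

Lemma mxpseries_lim a A (L : 'M[R]_n) :
  series (fun k => a k *: A ^+ k) @ \oo --> L -> mxpseries a A = L.
Proof. exact: cvg_lim. Qed.

Lemma mxpseriesD a b A : expdom a -> expdom b ->
  mxpseries (a \+ b) A = mxpseries a A + mxpseries b A.
Proof.
move=> /cvg_mxpseries - /(_ A) aA /cvg_mxpseries - /(_ A) bA.
apply: mxpseries_lim; rewrite (_ : (fun k => _) =
  (fun k => a k *: A ^+ k) + (fun k => b k *: A ^+ k)); last first.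
  by apply/funext => k; rewrite scalerDl.
by rewrite seriesD; apply: cvgD.
Qed.

Lemma mxpseriesZ s a A : expdom a ->
  mxpseries (s \*o a) A = s *: mxpseries a A.
Proof.
move=> /cvg_mxpseries - /(_ A) aA.
apply: mxpseries_lim; rewrite (_ : (fun k => _) =
  s *: (fun k => a k *: A ^+ k)); last first.
  by apply/funext => k; rewrite -scalerA.
by rewrite seriesZ; apply: cvgZr.
Qed.

(** The termwise bounds survive summation: this is how every matrix estimate
    below reduces to an estimate of scalar coefficients. *)
Lemma mxpseries_dom a b A B : expdom b -> (forall k, `|a k| <= b k) ->
  mxdom A B -> mxdom (mxpseries a A) (mxpseries b B).
Proof.
move=> eb ab AB i j.
have /cvg_mxP/(_ i j) aA := cvg_mxpseries (A := A) (expdom_le ab eb).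
have /cvg_mxP/(_ i j) bB := cvg_mxpseries (A := B) eb.
apply: (ler_cvg_to (cvg_norm aA) bB).
near=> N; rewrite !summxE (le_trans (ler_norm_sum _ _ _))//.
by apply: ler_sum => k _; apply: mxdomZ => //; exact: mxdom_exp.
Unshelve. all: by end_near. Qed.

End PowerSeries.

(** * The Cauchy product *)

Section CauchyProduct.
Context {R : realType} {n : nat}.
Implicit Types (a b : nat -> R) (s t : R) (A : 'M[R]_n).

Lemma partial_conv_coeff a b N k :
  (k < N)%N ->
  ((\poly_(i < N) a i) * (\poly_(i < N) b i))`_k = conv_coeff a b k.
Proof.
move=> kN; rewrite coefM; apply: eq_bigr => -[i] /= ik _.
by rewrite !coef_poly (leq_trans ik kN) (leq_ltn_trans (leq_subr _ _) kN).
Qed.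

Lemma norm_partial_conv_coeff a b N k :
  `|((\poly_(i < N) a i) * (\poly_(i < N) b i))`_k| <=
  conv_coeff (Num.norm \o a) (Num.norm \o b) k.
Proof.
rewrite coefM (le_trans (ler_norm_sum _ _ _))//; apply: ler_sum => i _.
rewrite normrM !coef_poly.
by apply: ler_pM => //=; case: ifP; rewrite ?normr0.
Qed.

Lemma series_horner_mx a m (B : 'M[R]_m.+1) N :
  series (fun k => a k *: B ^+ k) N = horner_mx B (\poly_(i < N) a i).
Proof.
rewrite /series /= big_mkord poly_def raddf_sum /=.
by apply: eq_bigr => i _; rewrite linearZ /= rmorphXn /= horner_mx_X.
Qed.

(** The blocks between ranks [N] and [2 N] are what a product of two partial
    sums of length [N] can contribute beyond rank [N]. *)
Lemma cvg_series_double (u : nat -> R) : cvgn (series u) ->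
  series u (N + N)%N - series u N @[N --> \oo] --> (0 : R).
Proof.
move=> cu; rewrite -(subrr (limn (series u))); apply: cvgB => //.
apply: (cvg_comp (fun N => N + N)%N _ _ cu).
move=> X [K _ KX]; exists K => // N /= KN; apply: KX.
exact: leq_trans KN (leq_addr _ _).
Qed.

(** A product of two partial sums of length [N] is a polynomial in [A] of
    degree less than [2 N], whose coefficients below [N] are exactly those of
    the convolution. The others are bounded by the convolution of absolute
    values, so the discrepancy is at most a block of a convergent series. *)
Lemma mxpseriesM a b A : expdom a -> expdom b ->
  mxpseries (conv_coeff a b) A = mxpseries a A *m mxpseries b A.
Proof.
(* [horner_mx] is a ring morphism on matrices of nonzero size. *)
case: n A => [|m] A ea eb; first by rewrite [LHS]flatmx0 [RHS]flatmx0.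
pose S u N := series (fun k => u k *: A ^+ k) N.
pose d N := S a N *m S b N - S (conv_coeff a b) N.
have d0 : d N @[N --> \oo] --> (0 : 'M[R]_m.+1).
  apply: norm_cvg0.
  have cw := is_cvg_norm_series (A := A) (expdom_conv ea eb).
  apply: (squeeze_cvgr _ (cvg_cst 0) (cvg_series_double cw)).
  near=> N; rewrite normr_ge0 /=.
  rewrite /d /S !series_horner_mx -[_ *m _]rmorphM -rmorphB /=.
  (* [p] collects the terms by which the two partial sums differ. *)
  set p := _ - _.
  have szd : (size p <= N + N)%N.
    rewrite (leq_trans (size_polyD _ _))// geq_max size_polyN.
    rewrite (leq_trans (size_polyMleq _ _)) ?(leq_trans (leq_pred _))//=;
      last by rewrite leq_add ?size_poly.
    by rewrite (leq_trans (size_poly _ _))// leq_addr.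
  have -> : p = \poly_(k < N + N) p`_k.
    apply/polyP => k; rewrite coef_poly; case: ltnP => // Nk.
    by rewrite nth_default// (leq_trans szd).
  rewrite -series_horner_mx sub_series_geq ?leq_addr//.
  rewrite /series /= (big_cat_nat (leq0n N)) ?leq_addr//=.
  rewrite big_nat_cond big1 ?add0r => [|k /andP[/andP[_ kN] _]]; last first.
    by rewrite /p coefB partial_conv_coeff// coef_poly kN subrr scale0r.
  rewrite (le_trans (ler_norm_sum _ _ _))//.
  apply: ler_sum_nat => k /andP[Nk _].
  rewrite normrZ ler_pM ?norm_mxexp_le//.
  rewrite /p coefB coef_poly ltnNge Nk subr0.
  by rewrite (le_trans (norm_partial_conv_coeff _ _ _ _))// ler_norm.
apply: mxpseries_lim; rewrite -[X in _ --> X]subr0.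
rewrite (_ : series _ = fun N => S a N *m S b N - d N); last first.
  by apply: funext => N; rewrite /d subKr.
apply: cvgB => //.
exact: (cvg_mulmx (cvg_mxpseries (A := A) ea) (cvg_mxpseries (A := A) eb)).
Unshelve. all: by end_near. Qed.

End CauchyProduct.

(** * The matrix exponential *)

Section Exponential.
Context {R : realType} {n : nat}.
Implicit Types (s t c delta : R) (A : 'M[R]_n).

Lemma mxexpZ s A k : (s *: A) ^+ k = s ^+ k *: A ^+ k.
Proof.
elim: k => [|k IHk]; first by rewrite !expr0 scale1r.
by rewrite !exprS IHk -[LHS]scalemxAl -[X in s *: X]scalemxAr scalerA.
Qed.

Lemma expmxZE s A : expmx (s *: A) = mxpseries (exp_coeff s) A.
Proof.
rewrite /expmx /mxpseries; congr (limn (series _)); apply: funext => k.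
by rewrite mxexpZ scalerA mulrC.
Qed.

(** Both factors are power series of the same matrix, so the identity is one
    of coefficients: the binomial formula. *)
Lemma expmx_scaleD s t A :
  expmx (s *: A) *m expmx (t *: A) = expmx ((s + t) *: A).
Proof.
rewrite !expmxZE -mxpseriesM; [|exact: expdom_exp_coeff..].
by congr mxpseries; apply: funext => k; rewrite exp_coeffD.
Qed.

Lemma expmx0 : expmx (0 : 'M[R]_n) = 1%:M.
Proof.
apply: mxpseries_lim; apply: cvg_near_cst.
near=> N; have [M ->] : exists M, N = M.+1.
  by exists N.-1; rewrite prednK//; near: N; exists 1%N.
rewrite /series /= big_mkord big_ord_recl expr0 fact0 invr1 scale1r.
by rewrite big1 ?addr0// => i _; rewrite expr0n scaler0.
Unshelve. all: by end_near. Qed.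

(** The coefficients of [P(A, c)]: the exponential series with its first two
    terms removed, shifted down by two. *)
Definition exptail2 c k : R := c ^+ k.+2 / k.+2`!%:R.

Lemma exptail2_bound c k : `|exptail2 c k| <= `|c| ^+ 2 * exp_coeff `|c| k.
Proof.
rewrite /exptail2 /exp_coeff /= normrM normrX normfV normr_nat -addn2 exprD.
rewrite [_ ^+ k * _]mulrC -mulrA ler_wpM2l// ler_wpM2l//.
rewrite lef_pV2 ?posrE ?ltr0n ?fact_gt0//.
by rewrite ler_nat addn2 !factS mulnA leq_pmull.
Qed.

Lemma expdom_exptail2 c : expdom (exptail2 c).
Proof. by exists (`|c| ^+ 2), `|c|; split=> // k; exact: exptail2_bound. Qed.

Lemma PmxE A c : Pmx A c = mxpseries (exptail2 c) A.
Proof. by []. Qed.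

Lemma expmx_Pmx c A : expmx (c *: A) = 1%:M + c *: A + Pmx A c *m A ^+ 2.
Proof.
rewrite expmxZE; apply: mxpseries_lim.
rewrite -(cvg_shiftn 2).
have cP := cvg_mxpseries (A := A) (expdom_exptail2 c).
have cA2 : (fun=> A ^+ 2) @ \oo --> A ^+ 2 by exact: cvg_cst.
rewrite (_ : [sequence _]_n = fun N => 1%:M + c *: A +
    series (fun k => exptail2 c k *: A ^+ k) N *m A ^+ 2); last first.
  apply: funext => N.
  rewrite /series /= addn2 !big_mkord 2!big_ord_recl /= addrA.
  rewrite /exp_coeff /= !expr0 !expr1 !divr1 scale1r.
  congr (_ + _); rewrite mulmx_suml; apply: eq_bigr => i _.
  by rewrite -scalemxAl /exptail2 -[_ *m _]exprD addn2.
apply: cvgD; [exact: cvg_cst|exact: cvg_mulmx].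
Qed.

End Exponential.

(** * Trajectories and their chords *)

Section Chord.
Context {R : realType} {n : nat}.
Implicit Types (s t c delta : R) (A B : 'M[R]_n) (x : 'cV[R]_n).

Lemma mxdom_Pmx A B delta : 0 <= delta -> mxdom A B ->
  mxdom (Pmx A delta) (Pmx B delta).
Proof.
move=> d0; apply: mxpseries_dom; first exact: expdom_exptail2.
by move=> k; rewrite ger0_norm// divr_ge0// exprn_ge0.
Qed.

(** The factor [delta^2] in [P] is weakened to [delta], the order of
    [Phi - 1], so that one linear rate serves for all terms. *)
Lemma mxdom_Pmx_expmx A B delta : 0 <= delta <= 1 -> mxdom A B ->
  mxdom (Pmx A delta) (delta *: expmx B).
Proof.
move=> /andP[d0 d1]; rewrite -[X in expmx X]scale1r expmxZE.
rewrite -mxpseriesZ; last exact: expdom_exp_coeff.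
apply: mxpseries_dom; first exact/expdomZ/expdom_exp_coeff.
move=> k; rewrite (le_trans (exptail2_bound _ _))//= ger0_norm//.
apply: ler_pM; rewrite ?exprn_ge0 ?exp_coeff_ge0//.
  by rewrite expr2 ler_piMl.
by rewrite /exp_coeff /= ler_wpM2r// expr1n exprn_ile1.
Qed.

(** The error of the chord is divisible by its parameter [s / delta], because
    the trajectory and the chord agree at [s = 0]; the quotient [e] is what
    must be added to the far endpoint. It is given by its own power series,
    which avoids dividing by [s]. *)
Lemma flow_chord A x s delta : 0 < delta -> 0 <= s <= delta ->
  exists2 e : 'cV[R]_n,
    mxdom e (Pmx (abs_mx A) delta *m map_mx Num.norm (A ^+ 2 *m x)) &
    expmx (s *: A) *m x = (1 - s / delta) *: x +
      (s / delta) *: (expmx (delta *: A) *m x + e).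
Proof.
move=> d0 /andP[s0 sd].
pose ek k : R := (s ^+ k.+1 * delta - delta ^+ k.+2) / k.+2`!%:R.
have ek_le k : `|ek k| <= exptail2 delta k.
  rewrite normrM [X in _ * X]ger0_norm// ler_wpM2r//.
  have h1 : s ^+ k.+1 <= delta ^+ k.+1 by rewrite ler_pXn2r// nnegrE// ltW.
  have h2 : 0 <= s ^+ k.+1 by rewrite exprn_ge0.
  rewrite ler0_norm; last by rewrite subr_le0 [leRHS]exprSr ler_wpM2r// ltW.
  by rewrite opprB lerBlDr lerDl mulr_ge0// ltW.
have eke : expdom ek := expdom_le ek_le (expdom_exptail2 delta).
exists (mxpseries ek A *m (A ^+ 2 *m x)).
  apply: mxdom_mul; last exact: mxdom_abs.
  by apply: mxpseries_dom (mxdom_abs A); first exact: expdom_exptail2.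
have PE : Pmx A s = (s / delta) *: (Pmx A delta + mxpseries ek A).
  rewrite !PmxE -mxpseriesD//; last exact: expdom_exptail2.
  rewrite -mxpseriesZ; last first.
    apply: (@expdom_le _ _ (fun k => 2 * exptail2 delta k)) => [k|].
      rewrite mulr2n mulrDl !mul1r (le_trans (ler_normD _ _))// lerD//.
      by rewrite ger0_norm// divr_ge0// exprn_ge0// ltW.
    exact: expdomZ (expdom_exptail2 delta).
  congr mxpseries; apply: funext => k /=; rewrite /exptail2 /ek.
  have : k.+2`!%:R != 0 :> R by rewrite pnatr_eq0 -lt0n fact_gt0.
  set f := _%:R => f0; rewrite -mulrDl addrC subrK [s ^+ k.+2]exprSr.
  by field; rewrite f0 gt_eqF.
rewrite !expmx_Pmx PE !mulmxDl !mul1mx -!scalemxAl !mulmxDl mulmxA.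
(* With the products named, the identity is one of scalars, entry by entry. *)
set P1 := _ *m x; set P2 := (_ *m _) *m x; set P3 := _ *m A ^+ 2 *m x.
apply/matrixP => i j; rewrite !mxE; field.
by rewrite gt_eqF.
Qed.

End Chord.

(** * The enclosure *)

Section Hulls.
Context {R : realType} {n : nat}.
Implicit Types (A : 'M[R]_n) (X Y : set 'cV[R]_n) (delta : R).

Lemma hyperrectangle0P (r x : 'cV[R]_n) : hyperrectangle 0 r x <-> mxdom x r.
Proof.
split=> [h i j|h i]; first by rewrite ord1; move: (h i); rewrite mxE subr0.
by rewrite mxE subr0.
Qed.

(** A centered hyperrectangle that contains [y] contains everything that is
    entrywise smaller in absolute value, and the hull is the intersection of
    those that contain [Y]. *)
Lemma sym_interval_hull_dom Y (y e : 'cV[R]_n) :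
  Y y -> mxdom e (map_mx Num.norm y) -> sym_interval_hull Y e.
Proof.
move=> Yy ey _ [[r ->] Yr]; apply/hyperrectangle0P.
by apply: (mxdom_trans ey); apply/mxdom_absl/hyperrectangle0P/Yr.
Qed.

Lemma dom_sym_interval_hull Y (r e : 'cV[R]_n) :
  (forall y, Y y -> mxdom y r) -> sym_interval_hull Y e -> mxdom e r.
Proof.
move=> Yr Ye; apply/hyperrectangle0P; apply: Ye; split; first by exists r.
by move=> y /Yr ?; apply/hyperrectangle0P.
Qed.

(** The vector [|A^2 y|] lies in the inner hull since the hull contains all
    sign changes of [A^2 y]. *)
Lemma Eplus_dom A Y delta (y e : 'cV[R]_n) : Y y ->
  mxdom e (Pmx (abs_mx A) delta *m map_mx Num.norm (A ^+ 2 *m y)) ->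
  Eplus A Y delta e.
Proof.
move=> Yy ey; apply: sym_interval_hull_dom (mxdom_absr ey).
exists (map_mx Num.norm (A ^+ 2 *m y)) => //.
apply: (@sym_interval_hull_dom _ (A ^+ 2 *m y)); first by exists y.
exact/mxdom_absl/mxdom_abs.
Qed.

Lemma dom_Eplus A Y delta (r e : 'cV[R]_n) : 0 <= delta ->
  (forall y, Y y -> mxdom y r) -> Eplus A Y delta e ->
  mxdom e (Pmx (abs_mx A) delta *m (abs_mx A ^+ 2 *m r)).
Proof.
move=> d0 Yr; apply: dom_sym_interval_hull => _ [z zY <-].
apply: mxdom_mul; first exact/mxdom_Pmx/mxdom_absl/mxdom_abs.
apply: dom_sym_interval_hull zY => _ [y Yy <-].
by apply: mxdom_mul; [exact/mxdom_exp/mxdom_abs|exact: Yr].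
Qed.

Lemma CH_conv X Y (x y : 'cV[R]_n) (l : R) : 0 <= l <= 1 ->
  X x -> Y y -> CH X Y ((1 - l) *: x + l *: y).
Proof.
move=> /andP[l0 l1] Xx Yy C [convC XYC].
have := convC y x (Itv01 l0 l1).
rewrite !inE addrC; apply; apply: XYC; [by right|by left].
Qed.

(** Stated with a set [Y] that contains the endpoint, so that it also applies
    to the reversed flow, whose endpoints lie in [X0] itself. *)
Lemma flow_CH A X Y x s delta : 0 < delta -> 0 <= s <= delta ->
  X x -> Y (expmx (delta *: A) *m x) ->
  CH X (minkowski_sum Y (Eplus A X delta)) (expmx (s *: A) *m x).
Proof.
move=> d0 sd Xx Yx; have /andP[s0 sd'] := sd.
have [e /(Eplus_dom Xx) Ee ->] := flow_chord A x d0 sd.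
apply: CH_conv => //; last by exists (expmx (delta *: A) *m x) => //; exists e.
by rewrite divr_ge0 ?ler_pdivrMr ?mul1r//= ltW.
Qed.

Lemma abs_mxN A : abs_mx (- A) = abs_mx A.
Proof. by apply/matrixP => i j; rewrite !mxE normrN. Qed.

Lemma EplusN A Y delta : Eplus (- A) Y delta = Eplus A Y delta.
Proof. by rewrite /Eplus abs_mxN sqrrN. Qed.

Lemma reach_sub_Omega0 A X delta : 0 < delta ->
  reach_set A X delta `<=` Omega0 A X delta.
Proof.
move=> d0 _ [s /= + [x Xx <-]]; rewrite in_itv/= => sd; split.
  by apply: flow_CH => //; exists x.
set Phi := expmx (delta *: A).
have revE t : expmx (t *: - A) *m (Phi *m x) = expmx ((delta - t) *: A) *m x.
  by rewrite mulmxA scalerN -scaleNr expmx_scaleD addrC.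
rewrite -[s in expmx (s *: A)](subKr delta) -revE /Omega0_minus -EplusN.
apply: flow_CH => //; [|by exists x|].
  by case/andP: sd => s0 sd; rewrite subr_ge0 sd gerBl s0.
by rewrite revE subrr scale0r expmx0 mul1mx.
Qed.

Lemma sub_reach_set A X delta : 0 <= delta -> X `<=` reach_set A X delta.
Proof.
move=> d0 x Xx; exists 0; first by rewrite /= in_itv/= lexx.
by exists x => //; rewrite scale0r expmx0 mul1mx.
Qed.

End Hulls.

(** * The limit *)

Section Limit.
Context {R : realType}.

Lemma convex_thickening (V : normedModType R) (X : set V) (e : R) :
  @convex_set R V X -> @convex_set R V (thickening X e).
Proof.
move=> convX x y l; rewrite !inE => -[x' Xx' xx'] [y' Yy' yy'].
exists (l%:num *: x' + (1 - l%:num) *: y').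
  by have := convX x' y' l; rewrite !inE; exact.
rewrite [X in `|X|](_ : _ = l%:num *: (x - x') + (1 - l%:num) *: (y - y')).
  rewrite (le_trans (ler_normD _ _))// !normrZ [`|l%:num|]ger0_norm//.
  rewrite [`|1 - _|]ger0_norm ?subr_ge0//.
  rewrite [leRHS](_ : _ = l%:num * e + (1 - l%:num) * e); last by ring.
  rewrite lerD//.
    by rewrite ler_wpM2l.
  by rewrite ler_wpM2l ?subr_ge0.
by rewrite !scalerBr opprD addrACA.
Qed.

Lemma hausdorff_distance_ge0 (V : normedModType R) (X Y : set V) :
  (0 <= hausdorff_distance X Y)%E.
Proof. by apply/ereal_infP => _ [e [e0 _ _] <-]; rewrite lee_fin. Qed.

Lemma hausdorff_distance_le (V : normedModType R) (X Y : set V) (e : R) :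
  0 <= e -> X `<=` thickening Y e -> Y `<=` thickening X e ->
  (hausdorff_distance X Y <= e%:E)%E.
Proof. by move=> e0 XY YX; apply: ereal_inf_lbound; exists e. Qed.

Lemma sub_thickening (V : normedModType R) (X : set V) (e : R) :
  0 <= e -> X `<=` thickening X e.
Proof. by move=> e0 x Xx; exists x; rewrite // subrr normr0. Qed.

Context {n : nat}.
Implicit Types (A : 'M[R]_n) (X Y : set 'cV[R]_n) (delta : R).

(** A smallest convex set is bounded by any convex set containing the
    generators: here a thickening of [X]. The displacement
    [Phi x + e - x = delta A x + P(A, delta) A^2 x + e] is bounded by
    [delta |A| r] plus twice [delta e^{|A|} |A|^2 r], which majorizes both
    the remainder of [Phi] and the points of [E^+]. *)
Lemma Omega0_plus_sub A X (r : 'cV[R]_n) delta : 0 <= delta <= 1 ->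
  @convex_set R 'cV[R]_n X -> (forall x, X x -> mxdom x r) ->
  Omega0_plus A X delta `<=` thickening X
   (delta * `|abs_mx A *m r + (expmx (abs_mx A) *m (abs_mx A ^+ 2 *m r)) *+ 2|).
Proof.
move=> d01 convX Xr; have /andP[d0 d1] := d01.
apply: smallest_sub; first exact: convex_thickening.
move=> y [Xy|]; first by apply: sub_thickening => //; rewrite mulr_ge0.
move=> [_ [x Xx <-]] [e /(dom_Eplus d0 Xr) er <-]; exists x => //.
have xr := Xr _ Xx; have AA := mxdom_abs A.
rewrite -{2}(ger0_norm d0) -normrZ; apply: mxdom_norm.
rewrite scalerDr mulr2n scalerDr expmx_Pmx !mulmxDl mul1mx.
rewrite -!addrA [X in mxdom X]addrC !addrA subrK -!addrA.
apply: mxdomD; last apply: mxdomD.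
- by rewrite -scalemxAl; apply: mxdomZ; [rewrite ger0_norm|exact: mxdom_mul].
- rewrite -mulmxA scalemxAl; apply: mxdom_mul; first exact: mxdom_Pmx_expmx.
  by apply: mxdom_mul => //; exact: mxdom_exp.
- apply: (mxdom_trans er); rewrite scalemxAl; apply: mxdom_mul.
    exact/mxdom_Pmx_expmx/mxdom_absl.
  apply: mxdom_mul; first exact/mxdom_exp/mxdom_absl.
  by move=> i j; rewrite ger0_norm// (le_trans _ (xr i j)).
Qed.

Lemma cvg_hausdorff_Omega0 A X : @convex_set R 'cV[R]_n X -> bounded_set X ->
  hausdorff_distance (Omega0 A X delta) (reach_set A X delta)
    @[delta --> 0^'+] --> 0%E.
Proof.
move=> convX [M0 [_ XM]].
have Xr x : X x -> mxdom x (const_mx (M0 + 1)).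
  by move=> Xx; apply/mxdom_const_norm/XM => //; rewrite ltrDl.
set r := const_mx _ in Xr.
pose K := `|abs_mx A *m r + (expmx (abs_mx A) *m (abs_mx A ^+ 2 *m r)) *+ 2|.
apply: (@squeeze_cvge _ _ _ _ (cst 0%E) _ (fun delta => (delta * K)%:E)).
- near=> delta.
  have d0 : 0 < delta by near: delta; exact: nbhs_right_gt.
  have d1 : delta <= 1 by near: delta; exact: nbhs_right_le.
  rewrite hausdorff_distance_ge0/=; apply: hausdorff_distance_le.
  + by rewrite mulr_ge0 ?normr_ge0 ?ltW.
  + have d01 : 0 <= delta <= 1 by rewrite d1 ltW.
    move=> y [/(Omega0_plus_sub d01 convX Xr) [x Xx yx] _].
    by exists x => //; exact: sub_reach_set (ltW d0) _ Xx.
  + apply: (subset_trans (reach_sub_Omega0 d0)); apply: sub_thickening.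
    by rewrite mulr_ge0 ?normr_ge0 ?ltW.
- exact: cvg_cst.
- apply: cvg_EFin; first by near=> delta.
  rewrite -[X in _ --> X](mul0r K); apply: cvgMl.
  exact: (cvg_at_right_filter (f := id)).
Unshelve. all: by end_near. Qed.

End Limit.

Theorem proposition1 (R : realType) (n : nat) (A : 'M[R]_n)
    (X0 : set 'cV[R]_n)
    (closedX0 : closed X0) (convexX0 : @convex_set R 'cV[R]_n X0) :
  (forall delta : R, 0 < delta ->
     reach_set A X0 delta `<=` Omega0 A X0 delta) /\
  (bounded_set X0 ->
     hausdorff_distance (Omega0 A X0 delta) (reach_set A X0 delta)
       @[delta --> 0^'+] --> 0%E).
Proof.
split; first by move=> delta d0; exact: reach_sub_Omega0.
by move=> bX0; exact: cvg_hausdorff_Omega0.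
Qed.
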